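(* The problems $\mathsf{G}_\geq$ and $\mathsf{K}_\geq$ are incomparable with respect to Weihrauch reducibility, i.e. $\mathsf{G}_\geq\,|_{\mathrm W}\,\mathsf{K}_\geq$, and $\mathsf{K}_\geq<_{\mathrm W}\mathsf{G}$.
   Context: Weihrauch complexity. $f:\subseteq X\rightrightarrows Y$ denotes a partial multivalued map. A represented space $(X,\delta_X)$ is a set $X$ with a surjective partial map $\delta_X:\subseteq\mathbb N^{\mathbb N}\to X$. A partial function $F:\subseteq\mathbb N^{\mathbb N}\to\mathbb N^{\mathbb N}$ is a realizer of $f:\subseteq X\rightrightarrows Y$, written $F\vdash f$, if $\delta_YF(p)\in f(\delta_X(p))$ for all $p\in\mathrm{dom}(f\delta_X)$. A problem is a multivalued map on represented spaces that has a realizer. $\mathbb N^{\mathbb N}$, $\mathbb N$ and products carry the standard representations; $\langle\cdot\rangle$ denotes standard pairing/tupling. $f\leq_{\mathrm W}g$ holds if there are computable $H,L:\subseteq\mathbb N^{\mathbb N}\to\mathbb N^{\mathbb N}$ such that $H\langle\mathrm{id},\Gamma L\rangle\vdash f$ whenever $\Gamma\vdash g$. $f\,|_{\mathrm W}\,g$ means $f\not\leq_{\mathrm W}g$ and $g\not\leq_{\mathrm W}f$; $f<_{\mathrm W}g$ means $f\leq_{\mathrm W}g$ and $g\not\leq_{\mathrm W}f$. Gödel problem and variants. $\varphi$ is a fixed standard (acceptable) Gödel numbering of the partial computable functions $\subseteq\mathbb N\to\mathbb N$. - $\mathsf{G}:\subseteq\mathbb N^{\mathbb N}\rightrightarrows\mathbb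 N$, $\mathsf{G}(p)=\{i\in\mathbb N:\varphi_i=p\}$, with domain the set of all (total) computable sequences $p\in\mathbb N^{\mathbb N}$; put $\mathsf{K}(p)=\min\mathsf{G}(p)$. - $\mathsf{G}_\geq:\subseteq\mathbb N^{\mathbb N}\times\mathbb N\rightrightarrows\mathbb N$, $\mathsf{G}_\geq(p,m)=\mathsf{G}(p)$, with domain $\{(p,m):p\in\mathrm{dom}(\mathsf G),\ m\geq\mathsf{K}(p)\}$. - $\mathsf{K}_\geq:\subseteq\mathbb N^{\mathbb N}\rightrightarrows\mathbb N$, $\mathsf{K}_\geq(p)=\{m\in\mathbb N:m\geq\mathsf{K}(p)\}$, $\mathrm{dom}(\mathsf K_\geq)=\mathrm{dom}(\mathsf G)$. *)

(* Defs.v *)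
From mathcomp Require Import all_boot.
From mathcomp Require Import boolp classical_sets.

Set Implicit Arguments.
Unset Strict Implicit.
Unset Printing Implicit Defensive.

Local Open Scope classical_set_scope.

(* Partial functions; None means "undefined". *)
Definition pfun (X Y : Type) := X -> option Y.

Definition baire := nat -> nat.

(* [code O n]: programs for n-ary partial functions on nat that may query a
   family of oracles indexed by O.  Programs without oracles are [code void n]. *)
Inductive code (O : Type) : nat -> Type :=
| Zero n : code O n
| Succ : code O 1
| Proj n (i : 'I_n) : code O n
| Comp m n (f : code O m) (g : 'I_m -> code O n) : code O n
| PrimRec n (f : code O n) (g : code O n.+2) : code O n.+1
| Mu n (f : code O n.+1) : code O n
| Query (o : O) : code O 1.

(* Kleene's mu-recursive functions; [eval q c v y]: on input v and with oracles
   q, the program c halts with output y.  Evaluation is strict, and minimization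
   requires f to halt (with a nonzero value) on all arguments below the least
   zero. *)
Fixpoint eval (O : Type) (q : O -> baire) (n : nat) (c : code O n) :
    n.-tuple nat -> nat -> Prop :=
  match c in code _ n return n.-tuple nat -> nat -> Prop with
  | Zero _ => fun _ y => y = 0
  | Succ => fun v y => y = (thead v).+1
  | Proj _ i => fun v y => y = tnth v i
  | Comp m _ f g => fun v y =>
      exists w : m.-tuple nat,
        (forall i, eval q (g i) v (tnth w i)) /\ eval q f w y
  | PrimRec n f g => fun v y =>
      let u : n.-tuple nat := [tuple of behead v] in
      (fix rec (k y : nat) : Prop :=
         match k with
         | 0 => eval q f u y
         | k'.+1 => exists z, rec k' z /\ eval q g [tuple of k' :: z :: u] y
         end) (thead v) y
  | Mu _ f => fun v y =>
      eval q f [tuple of y :: v] 0 /\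
      (forall z, z < y -> exists w, eval q f [tuple of z :: v] w.+1)
  | Query o => fun v y => y = q o (thead v)
  end.

Definition no_oracle : void -> baire := of_void baire.

Definition partial_computable n (f : pfun (n.-tuple nat) nat) : Prop :=
  exists c : code void n, forall v y, eval no_oracle c v y <-> f v = Some y.

Definition partial_computable1 (f : pfun nat nat) : Prop :=
  partial_computable (fun v : 1.-tuple nat => f (tnth v ord0)).

Definition partial_computable2 (f : nat -> pfun nat nat) : Prop :=
  partial_computable (fun v : 2.-tuple nat => f (tnth v ord0) (tnth v ord_max)).

Definition computable_seq (p : baire) : Prop :=
  partial_computable1 (fun n => Some (p n)).

(* Computability on Baire space: one program computes F(p)(n) from n with p as
   its oracle, for every p in dom F.  As usual for Weihrauch reducibility, nothing
   is required outside dom F, so restrictions of computable F are computable. *)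
Definition computable (F : pfun baire baire) : Prop :=
  exists c : code unit 1,
    forall p r, F p = Some r -> forall n, eval (fun=> p) c [tuple n] (r n).

(* Universal function theorem and smn theorem (in the form: every partial
   computable psi translates computably into phi); see [acceptable_computable]
   and [acceptable_surj] for the numbering property itself. *)
Definition acceptable (phi : nat -> pfun nat nat) : Prop :=
  partial_computable2 phi /\
  forall psi : nat -> pfun nat nat, partial_computable2 psi ->
    exists s : baire, computable_seq s /\ forall i, phi (s i) =1 psi i.

(* [names p x] is delta(p) = x for the partial surjection delta. *)
Record repr_space := ReprSpace {
  carrier :> Type;
  names : baire -> carrier -> Prop;
  names_fun : forall p x y, names p x -> names p y -> x = y;
  names_surj : forall x, exists p, names p x }.

Definition bpair (p q : baire) : baire :=
  fun n => if odd n then q n./2 else p n./2.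
Definition bfst (p : baire) : baire := fun n => p n.*2.
Definition bsnd (p : baire) : baire := fun n => p n.*2.+1.

Lemma bpairK1 p q : bfst (bpair p q) = p.
Proof. by apply/funext => n; rewrite /bfst /bpair odd_double doubleK. Qed.

Lemma bpairK2 p q : bsnd (bpair p q) = q.
Proof.
by apply/funext => n; rewrite /bsnd /bpair /= odd_double /= uphalf_double.
Qed.

Lemma bpairK p : bpair (bfst p) (bsnd p) = p.
Proof.
apply/funext => n; rewrite /bfst /bsnd /bpair -[in RHS](odd_double_half n).
by case: (odd n).
Qed.

Definition baire_repr : repr_space.
Proof.
refine (@ReprSpace baire (fun p x => p = x) _ _).
- by move=> p x y <-.
- by move=> x; exists x.
Defined.

Definition nat_repr : repr_space.
Proof.
refine (@ReprSpace nat (fun p x => p 0 = x) _ _).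
- by move=> p x y <-.
- by move=> x; exists (fun=> x).
Defined.

Definition prod_repr (X Y : repr_space) : repr_space.
Proof.
refine (@ReprSpace (X * Y)
  (fun p z => names (bfst p) z.1 /\ names (bsnd p) z.2) _ _).
- move=> p [x y] [x' y'] /= [px py] [px' py'].
  by rewrite (names_fun px px') (names_fun py py').
- move=> [x y] /=; have [p px] := names_surj x; have [q qy] := names_surj y.
  by exists (bpair p q); rewrite bpairK1 bpairK2.
Defined.

(* Partial multivalued maps; the domain consists of the x with f(x) nonempty. *)
Definition multimap (X Y : Type) := X -> set Y.

Definition mdom X Y (f : multimap X Y) : set X := [set x | f x !=set0].

Definition realizes (X Y : repr_space) (F : pfun baire baire)
    (f : multimap X Y) : Prop :=
  forall p x, names p x -> mdom f x ->
    exists r y, [/\ F p = Some r, names r y & f x y].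

(* By choice, every multivalued map between represented spaces is a problem, so
   Weihrauch reducibility needs no realizability side condition. *)
Lemma realizer_exists (X Y : repr_space) (f : multimap X Y) :
  exists F, realizes F f.
Proof.
have /choice[F FP] : forall p, exists r : baire, forall x, names p x ->
    mdom f x -> exists y, names r y /\ f x y.
  move=> p; have [[x [px [y fxy]]]|nx] :=
      pselect (exists x, names p x /\ mdom f x).
    have [r ry] := names_surj y; exists r => x' px' _.
    by rewrite (names_fun px' px); exists y.
  by exists p => x px fx; case: nx; exists x.
exists (fun p => Some (F p)) => p x px fx.
by have [y [ry fxy]] := FP p x px fx; exists (F p), y.
Qed.

(* p |-> H <p, Gamma (L p)> *)
Definition wcompose (H L Gamma : pfun baire baire) : pfun baire baire :=
  fun p => obind (fun r => H (bpair p r)) (obind Gamma (L p)).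

Definition weihrauch_le (X Y U V : repr_space)
    (f : multimap X Y) (g : multimap U V) : Prop :=
  exists H L : pfun baire baire,
    [/\ computable H, computable L
      & forall Gamma, realizes Gamma g -> realizes (wcompose H L Gamma) f].

Definition weihrauch_lt (X Y U V : repr_space)
    (f : multimap X Y) (g : multimap U V) : Prop :=
  weihrauch_le f g /\ ~ weihrauch_le g f.

Definition weihrauch_incomparable (X Y U V : repr_space)
    (f : multimap X Y) (g : multimap U V) : Prop :=
  ~ weihrauch_le f g /\ ~ weihrauch_le g f.

(* Its domain is the set of computable sequences; see [mdom_godel]. *)
Definition godel (phi : nat -> pfun nat nat) : multimap baire_repr nat_repr :=
  fun p : baire => [set i : nat | forall n, phi i n = Some (p n)].

(* [godel_min phi p k] is k = K(p). *)
Definition godel_min (phi : nat -> pfun nat nat) (p : baire) (k : nat) : Prop :=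
  godel phi p k /\ forall j : nat, godel phi p j -> k <= j.

Definition K_ge (phi : nat -> pfun nat nat) : multimap baire_repr nat_repr :=
  fun p : baire => [set m : nat | exists k, godel_min phi p k /\ k <= m].

Definition G_ge (phi : nat -> pfun nat nat) :
    multimap (prod_repr baire_repr nat_repr) nat_repr :=
  fun x : baire * nat => [set i : nat | godel phi x.1 i /\ K_ge phi x.1 x.2].

Fixpoint const_code O n (k : nat) : code O n :=
  if k is k'.+1 then Comp (Succ O) (fun=> const_code O n k') else Zero O n.

Lemma eval_const O (q : O -> baire) n k (v : n.-tuple nat) y :
  eval q (const_code O n k) v y <-> y = k.
Proof.
elim: k y => [|k IHk] y //=; split.
  by case=> w [/(_ ord0) /IHk wk ->]; rewrite /thead wk.
by move=> ->; exists [tuple k]; split=> // i; apply/IHk; rewrite ord1.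
Qed.

Lemma acceptable_computable phi i :
  acceptable phi -> partial_computable1 (phi i).
Proof.
move=> [[c cP] _].
exists (Comp c (fun j : 'I_2 => if j == ord0 then const_code void 1 i
                                else Proj void (ord0 : 'I_1))) => v y /=.
split=> [[w [wP /cP]]|phiy].
  have /eval_const -> := wP ord0; by have /= -> := wP ord_max.
exists [tuple i; tnth v ord0]; split; last exact/cP.
by move=> j; case: ifP => [/eqP->|]; [exact/eval_const | case: j => -[|[]]].
Qed.

Lemma acceptable_surj phi (f : pfun nat nat) :
  acceptable phi -> partial_computable1 f -> exists i, phi i =1 f.
Proof.
move=> [_ smn] [c cP].
have [|s [_ sP]] := smn (fun _ => f); last by exists (s 0).
exists (Comp c (fun=> Proj void (ord_max : 'I_2))) => v y /=.
split=> [[w [/(_ ord0) <- /cP]] //|fy].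
by exists [tuple tnth v ord_max]; split=> [j|]; [rewrite ord1 | exact/cP].
Qed.

Lemma mdom_godel phi : acceptable phi -> mdom (godel phi) = computable_seq.
Proof.
move=> aphi; apply/seteqP; split=> p.
  move=> [i /= ip]; have := acceptable_computable i aphi.
  by rewrite /computable_seq; congr partial_computable1; apply/funext.
by case/(acceptable_surj (f := fun n => Some (p n)) aphi)=> i ip; exists i.
Qed.

Lemma mdom_K_ge phi : mdom (K_ge phi) = mdom (godel phi).
Proof.
apply/seteqP; split=> p; first by case=> m [k [[kp _] _]]; exists k.
move=> [i ip]; have exG : exists i : nat, `[< godel phi p i >].
  by exists i; apply/asboolP.
exists (ex_minn exG); case: ex_minnP => k /asboolP kp kmin.
by exists k; split=> //; split=> // j /asboolP; apply: kmin.
Qed.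

Lemma mdom_G_ge phi :
  mdom (G_ge phi) = [set x | mdom (godel phi) x.1 /\ K_ge phi x.1 x.2].
Proof.
apply/seteqP; split=> x; first by case=> i [ip Kx]; split=> //; exists i.
by case=> -[i ip] Kx; exists i.
Qed.

(* Main.v *)
Require Import Defs.
From mathcomp Require Import all_boot.
From mathcomp Require Import boolp classical_sets.

Set Implicit Arguments.
Unset Strict Implicit.
Unset Printing Implicit Defensive.

(** [K_ge] reduces to [godel] since an index i of p satisfies K(p) <= i.

    [K_ge] does not reduce to [G_ge] for topological reasons.  From the zero
    sequence, a reduction makes a query (q, m) with K(q) <= m.  Only the finitely
    many sequences with an index up to m are possible values of q, so by
    continuity every computable p that is close enough to 0 yields the same query,
    hence may be given the same answer and, closer still, produces the same number
    N.  But the computable sequences in a neighbourhood of 0 are not all among the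
    N + 1 sequences phi_0, ..., phi_N: a diagonal choice of one entry avoids them
    ([K_ge_not_le_G_ge]).

    [G_ge] does not reduce to [K_ge] for computability reasons.  Let L and H be
    the two halves of a reduction.  If phi_e is total and m is computable from e,
    then an index of L(phi_e, m) is computable from e ([godel_image]), so the
    answers of [K_ge] give no power: they can be replaced by a computable bound r.
    By the recursion theorem, take a program e that knows e, puts
    m = max(e, c) with c an index of the zero sequence, and prints 0 until the
    computation H((0, m), r) is seen to halt, and 1 afterwards.  When H halts, it
    has read only entries of 0 which phi_e shares, so it outputs the same index for
    0 and for phi_e, although these sequences differ ([G_ge_not_le_K_ge]).  As
    [G_ge] reduces to [godel], the latter does not reduce to [K_ge] either.

    Two facts on programs carry this.  A step-bounded evaluator [run] is total,
    looks only at oracle entries below its bound, and agrees with [eval] for large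
    bounds ([run_local], [run_sound], [run_complete]); this gives the use principle
    and hence continuity.  For each fixed program it is itself computable from the
    oracle ([definable_run]), and a computable oracle with a parameter can be
    substituted into a program ([oracle_subst]), so that halting within x steps on
    the oracle built from e is a computable property of (e, x). *)

(** * Tuples given by their entries *)

Definition fcons T n (x : T) (f : 'I_n -> T) (i : 'I_n.+1) : T :=
  oapp f x (unlift ord0 i).

Lemma fcons0 T n (x : T) (f : 'I_n -> T) : fcons x f ord0 = x.
Proof. by rewrite /fcons unlift_none. Qed.

Lemma fconsS T n (x : T) (f : 'I_n -> T) i : fcons x f (lift ord0 i) = f i.
Proof. by rewrite /fcons liftK. Qed.

Lemma fcons_rel S T (R : S -> T -> Prop) n x f y g :
  R x y -> (forall i : 'I_n, R (f i) (g i)) ->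
  forall i, R (fcons x f i) (fcons y g i).
Proof.
by move=> xy fg i; case: (unliftP ord0 i) => [j|] ->; rewrite ?fconsS ?fcons0.
Qed.

Lemma fcons_all T (P : T -> Prop) n x (f : 'I_n -> T) :
  P x -> (forall i, P (f i)) -> forall i, P (fcons x f i).
Proof. by move=> Px Pf i; rewrite /fcons; case: unliftP => [j|] _ /=. Qed.

Lemma mktuple_fcons T n (x : T) (f : 'I_n -> T) :
  mktuple (fcons x f) = [tuple of x :: mktuple f].
Proof.
apply: eq_from_tnth => i; case: (unliftP ord0 i) => [j|] ->.
  by rewrite tnthS !tnth_mktuple fconsS.
by rewrite tnth0 tnth_mktuple fcons0.
Qed.

Lemma fcons_tnth T n (x : T) (v : n.-tuple T) :
  mktuple (fcons x (tnth v)) = [tuple of x :: v].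
Proof.
rewrite mktuple_fcons; congr [tuple of _ :: _].
by apply: eq_from_tnth => i; rewrite tnth_mktuple.
Qed.

Lemma mktuple_tnth T n (v : n.-tuple T) : mktuple (tnth v) = v.
Proof. by apply: eq_from_tnth => i; rewrite tnth_mktuple. Qed.

Lemma behead_cons T n (x : T) (v : n.-tuple T) :
  [tuple of behead [tuple of x :: v]] = v.
Proof. exact: val_inj. Qed.

Lemma behead2_cons T n (x y : T) (v : n.-tuple T) :
  [tuple of behead [tuple of behead [tuple of x :: y :: v]]] = v.
Proof. exact: val_inj. Qed.

Lemma tuple1E T (v : 1.-tuple T) : v = [tuple thead v].
Proof. by apply: eq_from_tnth => i; rewrite ord1. Qed.

Lemma behead_mktuple T n (f : 'I_n.+1 -> T) :
  [tuple of behead (mktuple f)] = mktuple (fun i => f (lift ord0 i)).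
Proof.
apply: eq_from_tnth => i.
rewrite tnth_behead !tnth_mktuple; congr f.
by apply: val_inj; rewrite /= inordK // ltnS.
Qed.

(** * Step-bounded evaluation *)

(** The value is 0 if no result is found with fuel t, and y.+1 if the result is y.
    Fuel limits oracle queries to arguments below t, and unbounded searches to t
    steps; a search climbs from 0 while the searched function exceeds 1, that is
    while it halts with a nonzero value, and it stays at the first place where
    this fails. *)
Fixpoint run O (q : O -> baire) (t n : nat) (c : code O n) : n.-tuple nat -> nat :=
  match c in code _ n return n.-tuple nat -> nat with
  | Zero _ => fun _ => 1
  | Succ => fun v => (thead v).+2
  | Proj _ i => fun v => (tnth v i).+1
  | Comp _ _ f g => fun v =>
      if [forall i, 0 < run q t (g i) v]
      then run q t f (mktuple (fun i => (run q t (g i) v).-1)) else 0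
  | PrimRec n f g => fun v =>
      let u : n.-tuple nat := [tuple of behead v] in
      nat_rect (fun=> nat) (run q t f u)
        (fun k z => if 0 < z then run q t g (cons_tuple k (cons_tuple z.-1 u)) else 0)
        (thead v)
  | Mu _ f => fun v =>
      let y := iter t (fun y => y + (1 < run q t f [tuple of y :: v])) 0 in
      if run q t f [tuple of y :: v] == 1 then y.+1 else 0
  | Query o => fun v => if thead v < t then (q o (thead v)).+1 else 0
  end.

Lemma run_local O (q q' : O -> baire) t n (c : code O n) v :
  (forall o x, x < t -> q o x = q' o x) -> run q t c v = run q' t c v.
Proof.
move=> qq'; elim: c v => {n} /= [||||||].
- by [].
- by [].
- by [].
- move=> m n f IHf g IHg v.
  under [in LHS]eq_forallb do rewrite IHg.
  rewrite IHf; congr (if _ then run _ _ _ _ else _).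
  by apply: eq_from_tnth => i; rewrite !tnth_mktuple IHg.
- move=> n f IHf g IHg v; elim: (thead v) => /= [|k ->]; first exact: IHf.
  by rewrite IHg.
- move=> n f IHf v.
  rewrite (_ : iter _ _ _ =
    iter t (fun y => y + (1 < run q' t f [tuple of y :: v])) 0) ?IHf //.
  by apply: eq_iter => y; rewrite IHf.
- by move=> o v; case: ifP => // /qq' ->.
Qed.

Lemma run_sound O (q : O -> baire) t n (c : code O n) v y :
  run q t c v = y.+1 -> eval q c v y.
Proof.
elim: c v y => {n} /=.
- by move=> n v y [].
- by move=> v y [].
- by move=> n i v y [].
- move=> m n f IHf g IHg v y; case: ifP => // /forallP gP /IHf fP.
  eexists; split; last exact: fP.
  by move=> i; apply: IHg; rewrite tnth_mktuple prednK.
- move=> n f IHf g IHg v.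
  elim: (thead v) => /= [|k IHk] y; first exact: IHf.
  case: ifP => // zP /IHg yP; eexists; split; last exact: yP.
  by apply: IHk; rewrite prednK.
- move=> n f IHf v y; case: ifP => // /eqP runy [<-].
  split; first exact: IHf.
  suff below k z : z < iter k (fun y => y + (1 < run q t f [tuple of y :: v])) 0 ->
      exists w, eval q f [tuple of z :: v] w.+1 by move=> z; apply: below.
  elim: k z => //= k IHk z; set y' := iter k _ _ in IHk *.
  case: (ltnP 1) => [y1|_]; last by rewrite addn0; apply: IHk.
  rewrite addn1 ltnS leq_eqVlt => /predU1P[->|/IHk //].
  by exists (run q t f [tuple of y' :: v]).-2; apply: IHf;
    case: (run _ _ _ _) y1 => [|[]].
- by move=> o v y; case: ifP => // _ [].
Qed.

(** Combines the fuel bounds of finitely many subcomputations, such as the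
    arguments of a composition or the places visited by a search. *)
Lemma bounded_uniform (P : nat -> nat -> Prop) b :
  (forall i, i < b -> exists N, forall t, N <= t -> P i t) ->
  exists N, forall t, N <= t -> forall i, i < b -> P i t.
Proof.
elim: b => [|b IHb] Pb; first by exists 0.
have [N NP] := IHb (fun i ib => Pb i (ltnW ib)); have [M MP] := Pb b (ltnSn b).
exists (maxn N M) => t; rewrite geq_max => /andP[/NP Nt /MP Mt] i.
by rewrite ltnS leq_eqVlt => /predU1P[->|/Nt].
Qed.

Lemma run_complete O (q : O -> baire) n (c : code O n) v y :
  eval q c v y -> exists N, forall t, N <= t -> run q t c v = y.+1.
Proof.
elim: c v y => {n} /=.
- by move=> n v y ->; exists 0.
- by move=> v y ->; exists 0.
- by move=> n i v y ->; exists 0.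
- move=> m n f IHf g IHg v y [w [gw /IHf[N NP]]].
  have [|M MP] := @bounded_uniform
      (fun i t => forall im : i < m,
        run q t (g (Ordinal im)) v = (tnth w (Ordinal im)).+1) m.
    move=> i im; have [M MP] := IHg _ _ _ (gw (Ordinal im)).
    by exists M => t /MP tP im'; rewrite (bool_irrelevance im' im).
  exists (maxn N M) => t; rewrite geq_max => /andP[/NP Nt /MP Mt].
  have gP i : run q t (g i) v = (tnth w i).+1.
    by case: i => i im; apply: Mt.
  case: ifP => [_|/forallP[]]; last by move=> i; rewrite gP.
  by rewrite -Nt; congr run; apply: eq_from_tnth => i; rewrite tnth_mktuple gP.
- move=> n f IHf g IHg v; elim: (thead v) => /= [|k IHk] y; first exact: IHf.
  case=> z [/IHk[N NP] /IHg[M MP]]; exists (maxn N M) => t.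
  by rewrite geq_max => /andP[/NP -> /MP <-].
- move=> n f IHf v y [/IHf[N NP] fpos].
  have [|M MP] := @bounded_uniform
      (fun z t => 1 < run q t f [tuple of z :: v]) y.
    move=> z /fpos[w /IHf[M MP]]; by exists M => t /MP ->.
  exists (maxn (maxn N M) y) => t.
  rewrite !geq_max => /andP[/andP[/NP Nt /MP Mt] yt].
  (* With enough fuel the search climbs one step at a time and stops at y. *)
  have climb k : iter k (fun y => y + (1 < run q t f [tuple of y :: v])) 0
                 = minn k y.
    elim: k => [|k /= ->]; first by rewrite min0n.
    case: (ltnP k y) => [ky|yk].
      by rewrite (minn_idPl ky) Mt // addn1.
    by rewrite (minn_idPr (leqW yk)) Nt addn0.
  by rewrite climb (minn_idPr yt) Nt.
- by move=> o v y ->; exists (thead v).+1 => t ->.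
Qed.

Lemma eval_fun O (q : O -> baire) n (c : code O n) v y y' :
  eval q c v y -> eval q c v y' -> y = y'.
Proof.
move=> /run_complete[N NP] /run_complete[M MP].
by have := NP (maxn N M); rewrite leq_maxl MP ?leq_maxr // => /(_ isT)[].
Qed.

Lemma eval_continuous O (q : O -> baire) n (c : code O n) v y :
  eval q c v y -> exists N, forall q' : O -> baire,
    (forall o x, x < N -> q' o x = q o x) -> eval q' c v y.
Proof.
move=> /run_complete[N NP]; exists N => q' qq'.
by apply: (@run_sound _ _ N); rewrite (run_local _ _ qq') NP.
Qed.

(** * Uniformly computable total functions *)

(** One program serves all oracles, and it halts for every oracle and input. *)
Definition definable O n (F : (O -> baire) -> n.-tuple nat -> nat) : Prop :=
  exists c : code O n, forall q v y, eval q c v y <-> y = F q v.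

Lemma eval_comp O (q : O -> baire) m n (f : code O m) (g : 'I_m -> code O n) v w y :
  (forall i z, eval q (g i) v z <-> z = w i) ->
  eval q (Comp f g) v y <-> eval q f (mktuple w) y.
Proof.
move=> gw /=; split=> [[u [gu fy]]|fy].
  suff <- : u = mktuple w by [].
  by apply: eq_from_tnth => i; rewrite tnth_mktuple; apply/gw.
by exists (mktuple w); split=> // i; apply/gw; rewrite tnth_mktuple.
Qed.

(** The recursion inside [eval] at [PrimRec], with the interpretations of the two
    programs as parameters, so that the tuple of parameters can be rewritten. *)
Definition prim_rec (P : nat -> Prop) (Q : nat -> nat -> nat -> Prop) :=
  fix rec (k y : nat) : Prop :=
    if k is k'.+1 then exists z, rec k' z /\ Q k' z y else P y.

Lemma eval_PrimRec O (q : O -> baire) n (f : code O n) g k (u : n.-tuple nat) y :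
  eval q (PrimRec f g) [tuple of k :: u] y <->
  prim_rec (eval q f u) (fun k z => eval q g [tuple of k :: z :: u]) k y.
Proof.
change (prim_rec (eval q f [tuple of behead [tuple of k :: u]])
  (fun k' z => eval q g
     (cons_tuple k' (cons_tuple z [tuple of behead [tuple of k :: u]])))
  (thead [tuple of k :: u]) y <->
  prim_rec (eval q f u) (fun k' z => eval q g (cons_tuple k' (cons_tuple z u))) k y).
by rewrite behead_cons theadE.
Qed.

Section Definable.
Variable O : Type.
Local Notation fn n := ((O -> baire) -> n.-tuple nat -> nat).

Lemma fcons_eval q n (v : n.-tuple nat) m (g0 : code O n) a g (w : 'I_m -> nat) :
  (forall z, eval q g0 v z <-> z = a) ->
  (forall i z, eval q (g i) v z <-> z = w i) ->
  forall i z, eval q (fcons g0 g i) v z <-> z = fcons a w i.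
Proof. exact: (fcons_rel (R := fun g w => forall z, eval q g v z <-> z = w)). Qed.

Lemma definable_const n k : definable (fun (_ : O -> baire) (_ : n.-tuple nat) => k).
Proof. by exists (const_code O n k) => q v y; apply: eval_const. Qed.

Lemma definable_proj n (i : 'I_n) :
  definable (fun (_ : O -> baire) (v : n.-tuple nat) => tnth v i).
Proof. by exists (Proj O i). Qed.

Lemma definable_comp n m (F : fn m) (G : 'I_m -> fn n) :
  definable F -> (forall i, definable (G i)) ->
  definable (fun q v => F q (mktuple (fun i => G i q v))).
Proof.
move=> [f fP] /choice[g gP]; exists (Comp f g) => q v y.
by rewrite -fP; apply: eval_comp => i z; apply: gP.
Qed.

Lemma definable_succ n (A : fn n) : definable A -> definable (fun q v => (A q v).+1).
Proof.
move=> dA; have dS : definable (fun (_ : O -> baire) (v : 1.-tuple nat) => (thead v).+1).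
  by exists (Succ O).
have := definable_comp (G := fun=> A) dS (fun=> dA); congr definable.
by apply/funext => q; apply/funext => v; rewrite /thead tnth_mktuple.
Qed.

Lemma definable_query o n (A : fn n) : definable A -> definable (fun q v => q o (A q v)).
Proof.
move=> dA; have dQ : definable (fun (q : O -> baire) (v : 1.-tuple nat) => q o (thead v)).
  by exists (Query o).
have := definable_comp (G := fun=> A) dQ (fun=> dA); congr definable.
by apply/funext => q; apply/funext => v; rewrite /thead tnth_mktuple.
Qed.

Lemma definable_rec n (A K : fn n) (B : fn n.+2) :
  definable A -> definable B -> definable K ->
  definable (fun q v =>
    nat_rect (fun=> nat) (A q v) (fun k z => B q [tuple of k :: z :: v]) (K q v)).
Proof.
move=> [a aP] [b bP] [k kP].
exists (Comp (PrimRec a b) (fcons k (fun i => Proj O i))) => q v y.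
rewrite (@eval_comp _ _ _ _ _ _ _ (fcons (K q v) (tnth v))); last first.
  exact: fcons_eval (kP q v) _.
rewrite fcons_tnth eval_PrimRec.
elim: (K q v) y => /= [|j IHj] y; first exact: aP.
split=> [[z [/IHj -> /bP]]//|->].
by eexists; split; [exact/IHj | exact/bP].
Qed.

Lemma definable_behead n (F : fn n) :
  definable F ->
  definable (fun q (v : n.+1.-tuple nat) => F q [tuple of behead v]).
Proof.
move=> /(@definable_comp n.+1 _ _ (fun i _ v => tnth v (lift ord0 i))) dF.
rewrite (_ : (fun q v => _) =
  fun q (v : n.+1.-tuple nat) => F q (mktuple (fun i => tnth v (lift ord0 i)))).
  by apply: dF => i; apply: definable_proj.
apply/funext => q; apply/funext => v; congr F.
by rewrite -[in LHS](mktuple_tnth v) behead_mktuple.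
Qed.

(** The step function B receives the parameter tuple whole, which frees later
    uses from handling tuples extended by the counter and the accumulator. *)
Lemma definable_nat_rect n (A K : fn n)
    (B : (O -> baire) -> n.-tuple nat -> nat -> nat -> nat) :
  definable A ->
  definable (fun q (v : n.+2.-tuple nat) =>
    B q [tuple of behead [tuple of behead v]] (tnth v ord0) (tnth v (lift ord0 ord0))) ->
  definable K ->
  definable (fun q v => nat_rect (fun=> nat) (A q v) (B q v) (K q v)).
Proof.
move=> dA dB dK; have := definable_rec dA dB dK; congr definable.
apply/funext => q; apply/funext => v; congr (nat_rect _ _ _ _).
by apply/funext => k; apply/funext => z; rewrite behead2_cons.
Qed.

Lemma definable_pred n (A : fn n) : definable A -> definable (fun q v => (A q v).-1).
Proof.
move=> dA.
have := definable_nat_rect (B := fun _ _ k _ => k)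
  (definable_const n 0) (definable_proj _) dA.
by congr definable; apply/funext => q; apply/funext => v; case: (A q v).
Qed.

Lemma definable_if n (A B K : fn n) : definable K -> definable A -> definable B ->
  definable (fun q v => if 0 < K q v then A q v else B q v).
Proof.
move=> dK dA dB.
have := definable_nat_rect (B := fun q v _ _ => A q v)
  dB (definable_behead (definable_behead dA)) dK.
by congr definable; apply/funext => q; apply/funext => v; case: (K q v).
Qed.

Lemma definable_add n (A B : fn n) :
  definable A -> definable B -> definable (fun q v => A q v + B q v).
Proof.
move=> dA dB.
have := definable_nat_rect (B := fun _ _ _ z => z.+1)
  dA (definable_succ (definable_proj _)) dB.
congr definable; apply/funext => q; apply/funext => v.
by elim: (B q v) => [|k /= ->]; rewrite ?addn0 ?addnS.
Qed.

Lemma definable_double n (A : fn n) : definable A -> definable (fun q v => (A q v).*2).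
Proof.
by move=> dA; under eq_fun do under eq_fun do rewrite -addnn; apply: definable_add.
Qed.

Lemma definable_sub n (A B : fn n) :
  definable A -> definable B -> definable (fun q v => A q v - B q v).
Proof.
move=> dA dB.
have := definable_nat_rect (B := fun _ _ _ z => z.-1)
  dA (definable_pred (definable_proj _)) dB.
congr definable; apply/funext => q; apply/funext => v.
by elim: (B q v) => [|k /= ->]; rewrite ?subn0 ?subnS.
Qed.

Lemma definable_ltn n (A B : fn n) :
  definable A -> definable B -> definable (fun q v => (A q v < B q v : nat)).
Proof.
move=> dA dB.
have := definable_if (definable_sub dB dA) (definable_const n 1) (definable_const n 0).
by congr definable; apply/funext => q; apply/funext => v; rewrite subn_gt0; case: ltnP.
Qed.

Lemma definable_ifb n (b : (O -> baire) -> n.-tuple nat -> bool) (A B : fn n) :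
  definable (fun q v => b q v : nat) -> definable A -> definable B ->
  definable (fun q v => if b q v then A q v else B q v).
Proof.
move=> db dA dB; have := definable_if db dA dB.
by congr definable; apply/funext => q; apply/funext => v; case: (b q v).
Qed.

Lemma definable_max n (A B : fn n) :
  definable A -> definable B -> definable (fun q v => maxn (A q v) (B q v)).
Proof. by move=> dA dB; apply: definable_ifb => //; apply: definable_ltn. Qed.

Lemma definable_negb n (b : (O -> baire) -> n.-tuple nat -> bool) :
  definable (fun q v => b q v : nat) -> definable (fun q v => ~~ b q v : nat).
Proof.
move=> db; have := definable_ifb db (definable_const n 0) (definable_const n 1).
by congr definable; apply/funext => q; apply/funext => v; case: (b q v).
Qed.

Lemma definable_andb n (b b' : (O -> baire) -> n.-tuple nat -> bool) :
  definable (fun q v => b q v : nat) -> definable (fun q v => b' q v : nat) ->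
  definable (fun q v => b q v && b' q v : nat).
Proof.
move=> db db'; have := definable_ifb db db' (definable_const n 0).
by congr definable; apply/funext => q; apply/funext => v; case: (b q v).
Qed.

Lemma definable_eqn n (A B : fn n) :
  definable A -> definable B -> definable (fun q v => (A q v == B q v : nat)).
Proof.
move=> dA dB.
have := definable_andb (definable_negb (definable_ltn dA dB))
  (definable_negb (definable_ltn dB dA)).
congr definable; apply/funext => q; apply/funext => v.
by rewrite -!leqNgt andbC -eqn_leq.
Qed.

Lemma definable_forall n m (F : 'I_m -> fn n) :
  (forall i, definable (F i)) ->
  definable (fun q v => [forall i, 0 < F i q v] : nat).
Proof.
elim: m F => [|m IHm] F dF.
  have := definable_const n 1; congr definable.
  apply/funext => q; apply/funext => v.
  by have -> : [forall i, 0 < F i q v] by apply/forallP => -[].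
have dF0 := definable_ltn (definable_const n 0) (dF ord0).
have := definable_andb dF0 (IHm _ (fun i => dF (lift ord0 i))).
congr definable; apply/funext => q; apply/funext => v; congr nat_of_bool.
apply/andP/forallP => [[F0 /forallP FS] i|FP].
  by case: (unliftP ord0 i) => [j|] ->.
by split=> //; apply/forallP.
Qed.

Lemma definable_odd n (A : fn n) :
  definable A -> definable (fun q v => odd (A q v) : nat).
Proof.
move=> dA.
have := definable_nat_rect (B := fun _ _ _ z => ~~ (0 < z)) (definable_const n 0)
  (definable_negb (definable_ltn (definable_const _ 0) (definable_proj _))) dA.
congr definable; apply/funext => q; apply/funext => v.
by elim: (A q v) => [|k /= ->] //; case: (odd k).
Qed.

Lemma definable_half n (A : fn n) :
  definable A -> definable (fun q v => (A q v)./2).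
Proof.
move=> dA.
have := definable_nat_rect (B := fun _ _ k z => odd k + z) (definable_const n 0)
  (definable_add (definable_odd (definable_proj _)) (definable_proj _)) dA.
congr definable; apply/funext => q; apply/funext => v.
by elim: (A q v) => [|k /= ->] //; rewrite uphalf_half.
Qed.

End Definable.

(** [run] recurses on the program only, so for a fixed program its graph is built
    from finitely many primitive recursions.  Fuel and arguments are arbitrary
    functions of a context: the recursion steps then only extend the context. *)
Lemma definable_run O n (c : code O n) m
    (T : (O -> baire) -> m.-tuple nat -> nat)
    (V : 'I_n -> (O -> baire) -> m.-tuple nat -> nat) :
  definable T -> (forall i, definable (V i)) ->
  definable (fun q v => run q (T q v) c (mktuple (fun i => V i q v))).
Proof.
elim: c m T V => {n} /=.
- by move=> n m T V _ _; apply: definable_const.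
- move=> m T V _ dV.
  rewrite (_ : (fun _ => _) = fun q v => (V ord0 q v).+2).
    by do 2!apply: definable_succ.
  by apply/funext => q; apply/funext => v; rewrite /thead tnth_mktuple.
- move=> n i m T V _ dV.
  rewrite (_ : (fun _ => _) = fun q v => (V i q v).+1).
    by apply: definable_succ.
  by apply/funext => q; apply/funext => v; rewrite tnth_mktuple.
- move=> k n f IHf g IHg m T V dT dV.
  apply: definable_ifb (definable_const _ _ _).
    by apply: definable_forall => i; apply: IHg.
  pose W i q v := (run q (T q v) (g i) (mktuple (fun j => V j q v))).-1.
  apply: (IHf _ _ W) => // i.
  by apply: definable_pred; apply: IHg.
- move=> n f IHf g IHg m T V dT dV.
  have dA := IHf _ _ _ dT (fun i => dV (lift ord0 i)).
  pose B q v k z := if 0 < z then run q (T q v) g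
    (cons_tuple k (cons_tuple z.-1 (mktuple (fun i => V (lift ord0 i) q v)))) else 0.
  under eq_fun do under eq_fun do rewrite behead_mktuple /thead tnth_mktuple.
  apply: (definable_nat_rect (B := B) dA _ (dV ord0)).
  rewrite /B; apply: definable_if.
  + exact: definable_proj.
  + pose W := fcons (fun (_ : O -> baire) (v : m.+2.-tuple nat) => tnth v ord0)
      (fcons (fun _ v => (tnth v (lift ord0 ord0)).-1)
       (fun i q v => V (lift ord0 i) q [tuple of behead [tuple of behead v]])).
    have := IHg _ _ W (definable_behead (definable_behead dT)).
    rewrite (_ : (fun q v => _) = fun q (v : m.+2.-tuple nat) =>
       run q (T q [tuple of behead [tuple of behead v]]) g
        [tuple of tnth v ord0 :: (tnth v (lift ord0 ord0)).-1 ::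
     mktuple (fun i => V (lift ord0 i) q [tuple of behead [tuple of behead v]])]).
      apply; apply: fcons_all; first exact: definable_proj.
      apply: fcons_all => [|i]; first exact: definable_pred (definable_proj _ _).
      exact: definable_behead (definable_behead (dV (lift ord0 i))).
    apply/funext => q; apply/funext => v; congr run.
    transitivity (mktuple (fcons (tnth v ord0) (fcons (tnth v (lift ord0 ord0)).-1
      (fun i => V (lift ord0 i) q [tuple of behead [tuple of behead v]])))).
      congr mktuple; apply/funext => i.
      rewrite /W /fcons; case: unliftP => [j|] _ //=.
      by case: unliftP.
    by rewrite !mktuple_fcons.
  + exact: definable_const.
- move=> n f IHf m T V dT dV.
  have dF k (A : (O -> baire) -> (k + m).-tuple nat -> nat) S
      (U : 'I_n -> (O -> baire) -> (k + m).-tuple nat -> nat) :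
      definable A -> definable S -> (forall i, definable (U i)) ->
      definable (fun q v => run q (S q v) f
        [tuple of A q v :: mktuple (fun i => U i q v)]).
    move=> dA dS dU; have := IHf _ _ (fcons A U) dS.
    rewrite (_ : (fun q v => _) = fun q v => run q (S q v) f
        [tuple of A q v :: mktuple (fun i => U i q v)]).
      by apply; apply: fcons_all.
    apply/funext => q; apply/funext => v; congr run.
    rewrite -mktuple_fcons; congr mktuple; apply/funext => i.
    by rewrite /fcons; case: unliftP.
  pose B q v (_ : nat) y :=
    y + (1 < run q (T q v) f [tuple of y :: mktuple (fun i => V i q v)]).
  pose Y q v := nat_rect (fun=> nat) 0 (B q v) (T q v).
  have dY : definable Y.
    apply: definable_nat_rect; [exact: definable_const| |exact: dT].
    apply: definable_add; first exact: definable_proj.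
    apply: definable_ltn; first exact: definable_const.
    apply: (dF 2 (fun _ v => tnth v (lift ord0 ord0))
      (fun q v => T q [tuple of behead [tuple of behead v]])
      (fun i q v => V i q [tuple of behead [tuple of behead v]])).
    + exact: definable_proj.
    + exact: definable_behead (definable_behead dT).
    + by move=> i; apply: definable_behead (definable_behead (dV i)).
  rewrite (_ : (fun q v => _) = fun q v =>
     if run q (T q v) f [tuple of Y q v :: mktuple (fun i => V i q v)] == 1
     then (Y q v).+1 else 0).
    apply: definable_ifb; last exact: definable_const.
      by apply: definable_eqn; [exact: (dF 0) | exact: definable_const].
    exact: definable_succ.
  apply/funext => q; apply/funext => v.
  suff iterE k : iter k (fun y : nat => y +
      (1 < run q (T q v) f [tuple of y :: mktuple (fun i => V i q v)])) 0 =
      nat_rect (fun=> nat) 0 (B q v) k by rewrite iterE.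
  by elim: k => //= k ->.
- move=> o m T V dT dV.
  rewrite (_ : (fun q v => _) = fun q v => if V ord0 q v < T q v then
      (q o (V ord0 q v)).+1 else 0).
    apply: definable_ifb; first exact: definable_ltn.
      by apply: definable_succ; apply: definable_query.
    exact: definable_const.
  by apply/funext => q; apply/funext => v; rewrite /thead tnth_mktuple.
Qed.

(** * Substituting a program for an oracle *)

(** The programs d compute the oracles q from a parameter a and possibly other
    oracles q'.  They may diverge for other parameters, which matters when they
    evaluate phi_a for an index a of a partial function. *)
Lemma oracle_subst O O' (d : O -> code O' 2) n (c : code O n) :
  exists c' : code O' n.+1, forall (q : O -> baire) (q' : O' -> baire) a,
    (forall o x y, eval q' (d o) [tuple a; x] y <-> y = q o x) ->
    forall (v : n.-tuple nat) y, eval q' c' [tuple of a :: v] y <-> eval q c v y.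
Proof.
elim: c => {n} /=.
- by move=> n; exists (Zero O' n.+1).
- exists (Comp (Succ O') (fun=> Proj O' ord_max)) => q q' a _ v y.
  rewrite (@eval_comp _ _ _ _ _ _ _ (fun=> thead v)) /=.
    by rewrite /thead tnth_mktuple.
  move=> _ z; rewrite (_ : ord_max = lift ord0 ord0) ?tnthS //; exact: val_inj.
- by move=> n i; exists (Proj O' (lift ord0 i)) => q q' a _ v y /=; rewrite tnthS.
- move=> m n f [f' fP] g /choice[g' gP].
  exists (Comp f' (fcons (Proj O' ord0) g')) => q q' a qa v y /=; split.
    case=> w [wP]; have := wP ord0; rewrite fcons0 /= tnth0 -/(thead w) => wa.
    rewrite (tuple_eta w) wa (fP _ _ _ qa) => fy.
    exists [tuple of behead w]; split=> //.
    by move=> i; have := wP (lift ord0 i); rewrite fconsS gP // {1}(tuple_eta w) tnthS.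
  case=> w [wP fy]; exists [tuple of a :: w]; split; last exact/fP.
  move=> i; case: (unliftP ord0 i) => [j|] ->.
    by rewrite fconsS gP // tnthS.
  by rewrite fcons0 /= !tnth0.
- move=> n f [f' fP] g [g' gP].
  pose i0 : 'I_n.+2 := ord0; pose i1 : 'I_n.+2 := lift ord0 ord0.
  pose i2 (i : 'I_n) : 'I_n.+2 := lift ord0 (lift ord0 i).
  (* The parameter a comes first in f' and g', but recursion is on the first
     argument: g'' and the outer composition exchange the places. *)
  pose g'' : code O' n.+3 := Comp g' (fcons (Proj O' (lift ord0 i1))
    (fcons (Proj O' ord0) (fcons (Proj O' (lift ord0 i0))
      (fun i => Proj O' (lift ord0 (i2 i)))))).
  exists (Comp (PrimRec f' g'')
    (fcons (Proj O' i1) (fcons (Proj O' i0) (fun i => Proj O' (i2 i))))).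
  move=> q q' a qa v y; set u : n.-tuple nat := [tuple of behead v].
  rewrite (@eval_comp _ _ _ _ _ _ _ (fcons (thead v) (fcons a (tnth u)))); last first.
    rewrite (tuple_eta v) theadE; apply: fcons_eval; first by rewrite /= tnthS tnth0.
    by apply: fcons_eval => [|i] /=; rewrite ?tnth0 // !tnthS.
  rewrite mktuple_fcons fcons_tnth eval_PrimRec.
  elim: (thead v) y => /= [|k IHk] y; first exact: fP.
  suff gE z : eval q' g'' [tuple of k :: z :: a :: u] y <->
              eval q g [tuple of k :: z :: u] y.
    split=> -[z [/IHk kz gy]]; exists z; split=> //; exact/gE.
  rewrite -(gP _ _ _ qa) /g''.
  rewrite (@eval_comp _ _ _ _ _ _ _ (fcons a (fcons k (fcons z (tnth u))))).
    by rewrite !mktuple_fcons mktuple_tnth.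
  apply: fcons_eval; first by rewrite /= /i1 !tnthS tnth0.
  apply: fcons_eval; first by rewrite /= tnth0.
  by apply: fcons_eval => [|i]; rewrite /= !tnthS ?tnth0.
- move=> n f [f' fP].
  pose f'' : code O' n.+2 := Comp f' (fcons (Proj O' (lift ord0 ord0))
    (fcons (Proj O' ord0) (fun i => Proj O' (lift ord0 (lift ord0 i))))).
  exists (Mu f'') => q q' a qa v y.
  suff fE z w : eval q' f'' [tuple of z :: a :: v] w <->
                eval q f [tuple of z :: v] w.
    rewrite /=; split=> -[fy fz]; (split; first exact/fE) => z /fz[w zw];
    by exists w; apply/fE.
  rewrite -(fP _ _ _ qa) /f''.
  rewrite (@eval_comp _ _ _ _ _ _ _ (fcons a (fcons z (tnth v)))).
    by rewrite !mktuple_fcons mktuple_tnth.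
  apply: fcons_eval; first by rewrite /= !tnthS tnth0.
  by apply: fcons_eval => [|i]; rewrite /= ?tnth0 // !tnthS.
- move=> o; exists (d o) => q q' a qa v y; rewrite -qa.
  suff -> : [tuple of a :: v] = [tuple a; thead v] by [].
  apply: eq_from_tnth => i; case: (unliftP ord0 i) => [j|] -> //.
  by rewrite tnthS ord1.
Qed.

(** * Indices *)

(** The partial function computed by a program exists by choice, and is unique
    because evaluation is deterministic. *)
Lemma smn_code phi (c : code void 2) : acceptable phi ->
  exists s, computable_seq s /\
    forall e x y, phi (s e) x = Some y <-> eval no_oracle c [tuple e; x] y.
Proof.
move=> [_ smn].
have /choice[f fP] : forall v : 2.-tuple nat, exists o,
    forall y, eval no_oracle c v y <-> o = Some y.
  move=> v; have [[y cy]|nc] := pselect (exists y, eval no_oracle c v y).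
    by exists (Some y) => z; split=> [/(eval_fun cy) -> //|[<-]].
  by exists None => z; split=> // cz; case: nc; exists z.
have [|s [cs sP]] := smn (fun e x => f [tuple e; x]).
  exists c => v y; rewrite fP; suff -> : v = [tuple tnth v ord0; tnth v ord_max] by [].
  apply: eq_from_tnth => i; case: i => [[|[|//]]] lt_i.
    by rewrite [RHS]/=; congr tnth; apply: val_inj.
  by rewrite [RHS]/=; congr tnth; apply: val_inj.
by exists s; split=> // e x y; rewrite sP fP.
Qed.

Lemma universal_code phi : acceptable phi ->
  exists u : code void 2, forall e x y,
    eval no_oracle u [tuple e; x] y <-> phi e x = Some y.
Proof. by move=> [[u uP] _]; exists u => e x y; rewrite uP. Qed.

Lemma computable_seqP (p : baire) : computable_seq p <->
  exists c : code void 1, forall x y, eval no_oracle c [tuple x] y <-> y = p x.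
Proof.
split=> -[c cP]; exists c.
  by move=> x y; rewrite cP; split=> [[]|->].
by move=> v y; rewrite {1}(tuple1E v) cP; split=> [->|[]].
Qed.

Lemma eval_comp2 O (q : O -> baire) n (f : code O 2) (g h : code O n) v y :
  eval q (Comp f (fcons g (fun=> h))) v y <->
  exists a b, [/\ eval q g v a, eval q h v b & eval q f [tuple a; b] y].
Proof.
split=> [[w [wP fy]]|[a [b [ga hb fy]]]].
  exists (tnth w ord0), (tnth w (lift ord0 ord0)); split.
  - by have := wP ord0; rewrite fcons0.
  - by have := wP (lift ord0 ord0); rewrite fconsS.
  - suff -> : [tuple tnth w ord0; tnth w (lift ord0 ord0)] = w by [].
    apply: eq_from_tnth => i; case: (unliftP ord0 i) => [j|] -> //.
    by rewrite ord1.
exists [tuple a; b]; split=> // i.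
by case: (unliftP ord0 i) => [j|] ->; rewrite ?fconsS ?ord1 ?fcons0.
Qed.

(** Diagonalization: if phi_i computes the translation s of the program
    (i, x) |-> c(phi_i(i), x), then e = s i is a fixed point. *)
Lemma recursion_theorem phi (c : code void 2) : acceptable phi ->
  exists e, forall x y, phi e x = Some y <-> eval no_oracle c [tuple e; x] y.
Proof.
move=> phiP; have [u uP] := universal_code phiP.
pose self : code void 2 := Comp u (fun=> Proj void ord0).
have [s [cs sP]] := smn_code (Comp c (fcons self (fun=> Proj void ord_max))) phiP.
have [i iP] := acceptable_surj (f := fun n => Some (s n)) phiP cs.
exists (s i) => x y; rewrite sP eval_comp2.
have selfP a : eval no_oracle self [tuple i; x] a <-> a = s i.
  rewrite (@eval_comp _ _ _ _ _ _ _ (fun=> i)) //.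
  rewrite (_ : mktuple _ = [tuple i; i]).
    by rewrite uP iP; split=> [[]|->].
  by apply: eq_from_tnth => j; rewrite tnth_mktuple; case: j => [[|[|]]].
split=> [[a [b [/selfP -> /= -> //]]]|ex].
by exists (s i), x; split; first exact/selfP.
Qed.

Lemma definable_computable_seq n (h : baire) (A : (void -> baire) -> n.-tuple nat -> nat) :
  computable_seq h -> definable A -> definable (fun q v => h (A q v)).
Proof.
move=> /computable_seqP[c cP] dA.
have dh : definable (fun (_ : void -> baire) (v : 1.-tuple nat) => h (thead v)).
  exists c => q v y; rewrite -cP (_ : q = no_oracle); last by apply/funext; case.
  by rewrite {1}(tuple1E v).
have := definable_comp (G := fun=> A) dh (fun=> dA); congr definable.
by apply/funext => q; apply/funext => v; rewrite /thead tnth_mktuple.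
Qed.

(** The use principle: a halting computation has read finitely many entries of
    its oracle, and so have the computations of the first n outputs together. *)
Lemma computable_continuous (F : pfun baire baire) p r n :
  computable F -> F p = Some r ->
  exists N, forall p' r', (forall x, x < N -> p' x = p x) -> F p' = Some r' ->
    forall i, i < n -> r' i = r i.
Proof.
move=> [c cP] Fp.
have [|N NP] := @bounded_uniform (fun i N => forall p' r',
    (forall x, x < N -> p' x = p x) -> F p' = Some r' -> r' i = r i) n.
  move=> i _; have [N NP] := eval_continuous (cP _ _ Fp i).
  exists N => t Nt p' r' pp' Fp'; apply: eval_fun (cP _ _ Fp' i) _.
  by apply: NP => _ x xN; apply: pp'; apply: leq_trans Nt.
by exists N => p' r' pp' Fp' i i_n; apply: (NP N (leqnn N) i i_n p' r').
Qed.

Lemma computable_precomp (F : pfun baire baire) (T : baire -> baire) :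
  computable F ->
  definable (fun (q : unit -> baire) (v : 1.-tuple nat) => T (q tt) (thead v)) ->
  computable (fun p => F (T p)).
Proof.
move=> [c cP] [d dP].
have [c' c'P] := oracle_subst (fun _ : unit => Comp d (fun=> Proj unit (ord_max : 'I_2))) c.
exists (Comp c' (fcons (Zero unit 1) (fun=> Proj unit ord0))) => p r Fr n.
apply/eval_comp2; exists 0, n; split=> //.
apply/(c'P (fun=> T p)); last exact: cP.
move=> o x y; rewrite (@eval_comp _ _ _ _ _ _ _ (fun=> x)) // dP.
by rewrite /thead tnth_mktuple.
Qed.

Section Godel.
Variables (phi : nat -> pfun nat nat) (phiP : acceptable phi).

Lemma godel_fun i p p' : godel phi p i -> godel phi p' i -> p = p'.
Proof. by move=> ip ip'; apply/funext => n; have := ip n; rewrite ip' => -[]. Qed.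

Lemma K_geP p m : K_ge phi p m <-> exists2 k, godel phi p k & k <= m.
Proof.
split=> [[k [[kp _] km]]|[i ip im]]; first by exists k.
have exG : exists i : nat, `[< godel phi p i >] by exists i; apply/asboolP.
exists (ex_minn exG); case: ex_minnP => k /asboolP kp kmin.
split; last by apply: leq_trans im; apply: kmin; apply/asboolP.
by split=> // j jp; apply: kmin; apply/asboolP.
Qed.

Lemma definable_godel (p : baire) :
  definable (fun (_ : void -> baire) (v : 1.-tuple nat) => p (thead v)) ->
  exists i, godel phi p i.
Proof.
move=> [c cP].
have /(acceptable_surj (f := fun n => Some (p n)) phiP)[i iP] : computable_seq p.
  by apply/computable_seqP; exists c => x y; rewrite cP theadE.
by exists i.
Qed.

(** With an index of p, the computable functional L can be run on phi instead of
    on an oracle, and smn turns the resulting program into an index of the image.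
    Hence a bound that [K_ge] returns on a query is itself computable. *)
Lemma godel_image (L : pfun baire baire) (h m : baire) :
  computable L -> computable_seq h -> computable_seq m ->
  exists g, computable_seq g /\ forall e p r, godel phi p (h e) ->
    L (bpair p (fun=> m e)) = Some r -> godel phi r (g e).
Proof.
move=> [c cP] hP mP; have [u uP] := universal_code phiP.
have [he heP] := definable_computable_seq hP (definable_proj void (ord0 : 'I_2)).
have [me meP] := definable_computable_seq mP (definable_proj void (ord0 : 'I_2)).
have [half halfP] := definable_half (definable_proj void (ord_max : 'I_2)).
have [sel selP] := definable_ifb (definable_odd (definable_proj void (lift ord0 ord0 : 'I_3)))
  (definable_proj void (lift ord0 (lift ord0 ord0))) (definable_proj void ord0).
(* d computes entry x of the oracle from (e, x): sel receives the entry x./2 of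
   p, the place x and m e, and chooses by the parity of x. *)
pose d : code void 2 := Comp sel (fcons (Comp u (fcons he (fun=> half)))
  (fcons (Proj void ord_max) (fun=> me))).
have [c' c'P] := oracle_subst (fun _ : unit => d) c.
have [g [gP gE]] := smn_code c' phiP.
exists g; split=> // e p r pe Lr n; apply/gE.
apply/(c'P (fun=> bpair p (fun=> m e))); last exact: cP.
move=> _ x y.
rewrite (@eval_comp _ _ _ _ _ _ _ (fcons (p x./2) (fcons x (fun=> m e)))).
  by rewrite selP !tnth_mktuple !fconsS !fcons0 /bpair.
apply: fcons_eval => [z|].
  rewrite eval_comp2; split=> [[a [b [/heP -> /halfP -> /uP]]]|->].
    by rewrite /= pe => -[].
  exists (h e), x./2; split; [exact/heP | exact/halfP | exact/uP].
by apply: fcons_eval => [z|_ z] //; apply: meP.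
Qed.

(** * Separations *)

Lemma half_leq n : n./2 <= n.
Proof. by rewrite leq_half_double -addnn -addnS leq_addr. Qed.

Lemma K_ge_le_godel : weihrauch_le (K_ge phi) (godel phi).
Proof.
exists (fun p => Some (bsnd p)), Some; split.
- have [c cP] : definable (fun (q : unit -> baire) (v : 1.-tuple nat) =>
      q tt (thead v).*2.+1).
    apply: definable_query; apply: definable_succ; apply: definable_double.
    exact: definable_proj.
  by exists c => p r [<-] n; apply/cP; rewrite theadE.
- by exists (Query tt) => p r [<-] n.
move=> Gamma GammaP p x /= px; rewrite mdom_K_ge => dx.
have [r [i [Gr ri ix]]] := GammaP p x px dx.
exists r, i; rewrite /wcompose /= Gr /= bpairK2; split=> //.
by apply/K_geP; exists i.
Qed.

(** The reduction is run on (0, m) and on (p, m) for a computable p that follows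
    the first computation and deviates from 0 only when that has finished. *)
Lemma G_ge_not_le_K_ge : ~ weihrauch_le (G_ge phi) (K_ge phi).
Proof.
move=> [H [L [[cH HP] cL red]]].
have [c0 c0P] : exists i, godel phi (fun=> 0) i.
  exact: definable_godel (definable_const _ _ 0).
have dproj n i : definable (fun _ v => tnth v i) := definable_proj void (i : 'I_n).
have seqP (h : baire) :
    definable (fun (_ : void -> baire) (v : 1.-tuple nat) => h (tnth v ord0)) ->
    computable_seq h.
  by move=> [c cP]; apply/computable_seqP; exists c => x y; rewrite cP.
pose m e := maxn e c0.
have mP : computable_seq m.
  by apply: seqP; apply: definable_max => //; apply: definable_const.
have [|g1 [g1P g1E]] := godel_image (h := id) cL _ mP; first exact: seqP.
have [|g2 [g2P g2E]] := godel_image (h := fun=> c0) cL _ mP.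
  by apply: seqP; apply: definable_const.
(* r e bounds the complexity of both queries L(p, m e) and L(0, m e). *)
pose r e := maxn (g1 e) (g2 e).
(* The oracle for H: the input (p, m e) with the answer r e. *)
pose q e p := bpair (bpair p (fun=> m e)) (fun=> r e).
have correct e p : godel phi p e \/ godel phi p c0 ->
    exists2 s, H (q e p) = Some s & godel phi p (s 0).
  move=> pe; have [G0 G0P] := realizer_exists (K_ge phi).
  (* Reducibility concerns all realizers, so it may be tested on one that
     answers r e whenever this is correct. *)
  pose Gamma l := if `[< K_ge phi l (r e) >] then Some (fun=> r e) else G0 l.
  have GammaP : realizes Gamma (K_ge phi).
    move=> l x /= <- dl; rewrite /Gamma; case: asboolP => [lr|_].
      by exists (fun=> r e), (r e).
    exact: G0P.
  have Kp : K_ge phi p (m e).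
    by apply/K_geP; case: pe => pe; [exists e | exists c0] => //;
      rewrite ?leq_maxl ?leq_maxr.
  have [||s [i [+ si [ip _]]]] := red _ GammaP (bpair p (fun=> m e)) (p, m e).
  - by rewrite /= bpairK1 bpairK2.
  - by rewrite mdom_G_ge; split=> //=; case: pe => pe; [exists e | exists c0].
  rewrite /wcompose; case Ll: (L _) => [l|] //=.
  rewrite /Gamma; case: asboolP => [_ /= Hs|[]]; last first.
    apply/K_geP; case: pe => pe.
      by exists (g1 e); [exact: g1E Ll | exact: leq_maxl].
    by exists (g2 e); [exact: g2E Ll | exact: leq_maxr].
  by exists s; rewrite ?si.
have [d dP] : definable (fun (_ : void -> baire) (v : 2.-tuple nat) =>
    q (tnth v ord0) (fun=> 0) (tnth v (lift ord0 ord0))).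
  apply: definable_ifb; first exact: definable_odd.
    by apply: definable_max; apply: definable_computable_seq.
  apply: definable_ifb; first by apply: definable_odd; apply: definable_half.
    exact: definable_computable_seq.
  exact: definable_const.
have zE : mktuple (fun _ : 'I_1 => 0) = [tuple 0].
  by apply: eq_from_tnth => i; rewrite tnth_mktuple ord1.
have [C CP] : definable (fun (q : unit -> baire) (v : 1.-tuple nat) =>
    0 < run q (tnth v ord0) cH [tuple 0] : nat).
  rewrite -zE.
  apply: definable_ltn; first exact: definable_const.
  by apply: definable_run => [|i]; [exact: definable_proj|exact: definable_const].
have [C' C'P] := oracle_subst (fun _ : unit => d) C.
have [e eP] := recursion_theorem C' phiP.
pose halts x := 0 < run (fun=> q e (fun=> 0)) x cH [tuple 0].
pose p x : nat := halts x.
have pe : godel phi p e.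
  move=> x; apply/eP/(C'P (fun=> q e (fun=> 0))); last exact/CP.
  by move=> _ x' y; rewrite dP.
have [s Hs s0] := correct e (fun=> 0) (or_intror c0P).
have [s' Hs' s'p] := correct e p (or_introl pe).
have exN : exists N, halts N.
  have [N NP] := run_complete (HP _ _ Hs 0).
  by exists N; rewrite /halts NP.
(* N is the place of the first 1 in p; p agrees with 0 below N. *)
pose N := ex_minn exN.
have [haltsN minN] : halts N /\ forall x, x < N -> p x = 0.
  rewrite /N; case: ex_minnP => M hM minM; split=> // x xM.
  by rewrite /p; case hx: (halts x) => //; have := minM _ hx; rewrite leqNgt xM.
have qq' x : x < N -> q e p x = q e (fun=> 0) x.
  move=> xN; rewrite /q /bpair; case: ifP => // _; case: ifP => // _.
  apply: minN; apply: leq_ltn_trans xN.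
  exact: leq_trans (half_leq _) (half_leq _).
have ss' : s 0 = s' 0.
  move: haltsN; rewrite /halts; case runN: run => [|y] // _.
  rewrite (eval_fun (HP _ _ Hs 0) (run_sound runN)).
  apply: esym; apply: eval_fun (HP _ _ Hs' 0) _.
  by apply: (@run_sound _ _ N); rewrite -runN; apply: run_local => _; apply: qq'.
have : p = (fun=> 0) by apply: (@godel_fun (s 0)); rewrite // ss'.
by move=> /(congr1 (@^~ N)); rewrite /p haltsN.
Qed.

(** An instance of transitivity: [G_ge] reduces to [godel] by forgetting the
    bound. *)
Lemma G_ge_le_of_godel_le : weihrauch_le (godel phi) (K_ge phi) ->
  weihrauch_le (G_ge phi) (K_ge phi).
Proof.
move=> [H [L [cH cL red]]].
exists (fun p => H (bpair (bfst (bfst p)) (bsnd p))), (fun p => L (bfst p)).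
have dx := definable_proj unit (ord0 : 'I_1).
split.
- apply: (computable_precomp (T := fun p => bpair (bfst (bfst p)) (bsnd p))) => //.
  apply: definable_ifb; first exact: definable_odd.
    apply: definable_query; apply: definable_succ; apply: definable_double.
    exact: definable_half.
  by apply: definable_query; do 2!apply: definable_double; apply: definable_half.
- apply: computable_precomp => //.
  by apply: definable_query; apply: definable_double.
move=> Gamma GammaP p [x m] [/= px pm]; rewrite mdom_G_ge => -[/= dx' Kx].
have [r [i [Hr ri ix]]] := red _ GammaP _ _ px dx'.
exists r, i; split=> //; move: Hr; rewrite /wcompose /=.
case: (L _) => [l|] //=; case: (Gamma l) => [g|] //=.
by rewrite bpairK1 bpairK2.
Qed.

(** The problem [K_ge] is unbounded near 0, while a query to [G_ge] and a correct
    answer to it can be kept constant near 0. *)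
Lemma K_ge_not_le_G_ge : ~ weihrauch_le (K_ge phi) (G_ge phi).
Proof.
move=> [H [L [cH cL red]]].
pose z : baire := fun=> 0.
have dz : mdom (K_ge phi) z.
  by rewrite mdom_K_ge; apply: definable_godel (definable_const _ _ 0).
have [G0 G0P] := realizer_exists (G_ge phi).
(* A realizer that is undefined outside the domain of G_ge shows that queries
   lie in that domain. *)
have Ldom p : mdom (K_ge phi) p -> exists2 l, L p = Some l &
    mdom (G_ge phi) (bfst l, bsnd l 0).
  move=> dp.
  pose Gamma l := if `[< mdom (G_ge phi) (bfst l, bsnd l 0) >] then G0 l else None.
  have [|r [N [+ _ _]]] := red Gamma _ p p erefl dp.
    move=> l [x m] [/= <- <-] dl; rewrite /Gamma asboolT //.
    exact: G0P.
  rewrite /wcompose; case: (L p) => [l|] //=.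
  by rewrite /Gamma; case: asboolP => // dl _; exists l.
have [l Ll] := Ldom z dz; rewrite mdom_G_ge => -[/= [i0 i0P] Kl].
set m := bsnd l 0 in Kl.
(* Below B the sequence bfst l differs from all other sequences with an index up
   to m. *)
have [B BP] : exists B, forall j, j < m.+1 ->
    (forall n, n < B -> phi j n = Some (bfst l n)) -> godel phi (bfst l) j.
  have [|B BP] := @bounded_uniform (fun j B =>
    (forall n, n < B -> phi j n = Some (bfst l n)) -> godel phi (bfst l) j) m.+1.
    move=> j _; have [jl|/existsNP[n jn]] := pselect (godel phi (bfst l) j).
      by exists 0.
    by exists n.+1 => t nt /(_ n nt).
  by exists B; apply: BP.
(* Place n of bfst l is place 2n of l, and the bound m is place 1 of l. *)
have [M1 M1P] := computable_continuous B.*2.+2 cL Ll.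
(* The answer to a query depends on its sequence only, so i0 can be returned for
   all bounds. *)
pose Gamma l' := if `[< bfst l' = bfst l >] then Some (fun=> i0) else G0 l'.
have GammaP : realizes Gamma (G_ge phi).
  move=> l' [x k] [/= <- l'k] dl'; rewrite /Gamma; case: asboolP => [E|_].
    exists (fun=> i0), i0; split=> //; split=> /=; first by rewrite E.
    by move: dl'; rewrite mdom_G_ge => -[].
  exact: G0P.
have [r [N [+ rN _]]] := red _ GammaP z z erefl dz.
rewrite /wcompose Ll /= /Gamma asboolT //= => Hr.
have [M2 M2P] := computable_continuous 1 cH Hr.
pose M := maxn M1 M2.
(* The entry a at place M excludes all indices up to N. *)
pose a := (\max_(k < N.+1) odflt 0 (phi k M)).+1.
pose p : baire := fun n => if n == M then a else 0.
have pz n : n < M -> p n = 0 by rewrite /p; case: ltngtP.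
have dp : mdom (K_ge phi) p.
  rewrite mdom_K_ge; apply: definable_godel.
  apply: definable_ifb; try exact: definable_const.
  by apply: definable_eqn; [exact: definable_proj | exact: definable_const].
have [l' Ll'] := Ldom p dp; rewrite mdom_G_ge => -[/= _ Kl'].
have ll' n : n < B.*2.+2 -> l' n = l n.
  apply: M1P Ll' _ => x xM1; rewrite pz //.
  by apply: leq_trans xM1 _; apply: leq_maxl.
have E : bfst l' = bfst l.
  have [k kl'] := (K_geP _ _).1 Kl'; rewrite {1}/bsnd ll' //= -/(bsnd l 0) => km.
  apply: (godel_fun kl'); apply: BP => // n nB; rewrite kl' /bfst ll' //.
  by rewrite ltnW // !ltnS leq_double ltnW.
have [r' [N' [+ r'N' pN']]] := red _ GammaP p p erefl dp.
rewrite /wcompose Ll' /= /Gamma asboolT //= => Hr'.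
have NN' : N' = N.
  rewrite -rN -r'N'; apply: M2P Hr' _ _ => // x xM2.
  rewrite /bpair; case: ifP => // _; apply: pz.
  apply: leq_trans (leq_maxr _ _); apply: leq_ltn_trans xM2.
  exact: half_leq.
have [k kp] := (K_geP _ _).1 pN'; rewrite NN' -ltnS => kN.
have := leq_bigmax (F := fun k : 'I_N.+1 => odflt 0 (phi k M)) (Ordinal kN).
by rewrite /= kp /= /p eqxx /a ltnn.
Qed.

End Godel.

Theorem proposition24 (phi : nat -> pfun nat nat) (phiP : acceptable phi) :
  weihrauch_incomparable (G_ge phi) (K_ge phi) /\
  weihrauch_lt (K_ge phi) (godel phi).
Proof.
split; split.
- exact: G_ge_not_le_K_ge.
- exact: K_ge_not_le_G_ge.
- exact: K_ge_le_godel.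
by move=> /G_ge_le_of_godel_le; apply: G_ge_not_le_K_ge.
Qed.
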